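(* There exists an irrational number $\alpha$ such that $\mathcal S(\alpha)=\mathbb R$.
   Context: For $\alpha\in\mathbb R$, $\mathcal S(\alpha)\subset\mathbb R$ denotes the set of all accumulation points of the set $\left\{ m^2\left(\frac{k}{m}-\alpha\right) : k,m\in\mathbb Z,\ m\neq 0\right\}$. The pairs $(k,m)$ are not required to be coprime. *)

(* Defs.v *)
From mathcomp Require Import all_boot all_order all_algebra.
From mathcomp Require Import boolp classical_sets reals topology normedtype.
Set Implicit Arguments.
Unset Strict Implicit.
Unset Printing Implicit Defensive.
Import Order.TTheory GRing.Theory Num.Theory.
Import numFieldNormedType.Exports.

Local Open Scope classical_set_scope.
Local Open Scope ring_scope.

Definition approx_values (R : realType) (alpha : R) : set R :=
  [set x | exists k m : int,
    m != 0 /\ x = m%:~R ^+ 2 * (k%:~R / m%:~R - alpha)].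

(* Accumulation points of a set of reals: every neighbourhood of the point
   meets the set at some other point, so multiplicities of representations by
   pairs (k, m) play no role. *)
Definition accumulation_set (R : realType) (alpha : R) : set R :=
  limit_point (approx_values alpha).

(* Main.v *)
Require Import Defs.
From mathcomp Require Import all_boot all_order all_algebra.
From mathcomp Require Import boolp classical_sets reals topology normedtype.
From mathcomp Require Import sequences ring lra.
Import Order.TTheory GRing.Theory Num.Theory.
Import numFieldNormedType.Exports.

(** Baire category.  For a nonempty open set O, the set of all alpha having
    some value m^2 (k/m - alpha) in O is open, and it is dense because it
    contains the numbers k/m - y/m^2 for any fixed y in O.  Letting O range
    over the balls with rational centre and radius, a generic alpha is
    irrational and has a dense set of values; a dense subset of the line
    accumulates everywhere. *)

Local Open Scope classical_set_scope.
Local Open Scope ring_scope.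

(** Pickling turns the family into a sequence, to which [Baire] applies. Codes of no index receive
    the whole space, which is open and dense. *)
Lemma Baire_countable (K : realType) (U : completeNormedModType K)
    (T : countType) (F : T -> set U) :
  (forall i, open (F i) /\ dense (F i)) -> dense (\bigcap_i F i).
Proof.
move=> odF.
pose G n := if unpickle n is Some i then F i else setT.
have odG n : open (G n) /\ dense (G n).
  rewrite /G; case: (unpickle n) => [i|]; first exact: odF.
  by split=> [|O O0 _]; [exact: openT | rewrite setIT].
move=> O O0 oO; have [x [Ox Gx]] := Baire odG O0 oO.
exists x; split=> // i _.
by have := Gx (pickle i) I; rewrite /G pickleK.
Qed.

Lemma dense_limit_point (R : realType) (V : set R) :
  dense V -> limit_point V = setT.
Proof.
move=> dV; apply/seteqP; split=> // x _ U /nbhs_ballP[e /= e0 xeU].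
(* This ball is the interval from [x] to [x + e]: it lies in the neighbourhood but omits [x], so the
   point of [V] found in it differs from [x]. *)
have [] := dV (ball (x + e / 2) (e / 2)).
- by exists (x + e / 2); apply: ballxx; rewrite divr_gt0.
- exact: ball_open.
move=> y []; rewrite -ball_normE /= => xy Vy; exists y; split=> //.
- by apply/eqP => yx; move: xy; rewrite yx ltr_norml => /andP[]; lra.
- apply: xeU; rewrite -ball_normE /=.
  by move: xy; rewrite !ltr_norml => /andP[? ?]; apply/andP; split; lra.
Qed.

Lemma dense_rat_balls (R : realType) (V : set R) :
  (forall c r : rat, ball (ratr c : R) (ratr r) !=set0 ->
     (ball (ratr c : R) (ratr r) `&` V) !=set0) ->
  dense V.
Proof.
move=> VP O [x Ox] oO.
have [|c [r [/set_mem cx cO]]] := @open_subball_rat R O x oO.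
  exact/mem_set.
have [|y [cy Vy]] := VP c r; first by exists x.
by exists y; split=> //; exact: cO.
Qed.

(** For fixed [k] and [m] the value is a continuous function of [alpha], so the set is a union of
    preimages of [O]. *)
Lemma open_approx_meets (R : realType) (O : set R) :
  open O -> open [set alpha : R | (O `&` approx_values alpha) !=set0].
Proof.
move=> oO.
pose f (km : int * int) (alpha : R) : R :=
  km.2%:~R ^+ 2 * (km.1%:~R / km.2%:~R - alpha).
rewrite (_ : [set _ | _] = \bigcup_(km in [set km | km.2 != 0]) (f km @^-1` O)).
  apply: bigcup_open => km _; apply: open_comp => // alpha _.
  by apply: cvgM; [exact: cvg_cst | apply: cvgB; [exact: cvg_cst | exact: cvg_id]].
apply/seteqP; split=> [alpha [x [Ox [k [m [m0 xE]]]]]|alpha [[k m] m0 Of]].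
  by exists (k, m) => //=; rewrite /f /= -xE.
by exists (f (k, m) alpha); split=> //; exists k, m.
Qed.

Lemma dense_approx_meets (R : realType) (O : set R) :
  O !=set0 -> dense [set alpha : R | (O `&` approx_values alpha) !=set0].
Proof.
move=> [y Oy] P [a Pa] oP.
have /nbhs_ballP[e /= e0 aeP] : nbhs a P by exact: open_nbhs_nbhs.
(* With [k] the floor of [a * n], the witness below is within 1/n + |y|/n^2 of [a], hence within (1
   + |y|)/n; this [n] makes that bound less than [e]. *)
pose n := (Num.truncn ((1 + `|y|) / e)).+1.
have n0 : 0 < n%:R :> R by rewrite ltr0n.
have n1 : 1 <= n%:R :> R by rewrite ler1n.
have nE : (1 + `|y|) / n%:R < e.
  by rewrite ltr_pdivrMr// mulrC -ltr_pdivrMr// truncnS_gt.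
pose k := Num.floor (a * n%:R).
have /andP[k1 k2] := floor_itv (a * n%:R); rewrite -/k intrD in k1 k2.
(* This is the solution [alpha] of n^2 (k/n - alpha) = y. *)
exists (k%:~R / n%:R - y / n%:R ^+ 2); split.
  apply: aeP; rewrite -ball_normE /=.
  apply: le_lt_trans nE; rewrite mulrDl.
  rewrite (_ : a - _ = (a * n%:R - k%:~R) / n%:R + y / n%:R / n%:R); last first.
    by field; rewrite gt_eqF.
  rewrite (le_trans (ler_normD _ _))// lerD//.
    rewrite normrM normfV (gtr0_norm n0) ler_pM2r ?invr_gt0//.
    by rewrite ler_norml; apply/andP; split; lra.
  rewrite !normrM normfV (gtr0_norm n0) ler_pdivrMr// ler_peMr//.
  by rewrite mulr_ge0// invr_ge0 ltW.
exists y; split=> //; exists k, (n%:Z); split=> //.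
by rewrite -pmulrn; field; rewrite gt_eqF.
Qed.

Theorem theorem16 (R : realType) :
  exists alpha : R, irrational alpha /\ accumulation_set alpha = [set: R]%classic.
Proof.
pose B (cr : rat * rat) : set R := ball (ratr cr.1 : R) (ratr cr.2).
(* Each condition also excludes the centre of its ball; as centres run over all rationals, a common
   point is irrational. The implication makes the condition on values vacuous for empty balls, those
   of nonpositive radius. *)
pose F cr : set R := ~` [set ratr cr.1] `&`
  [set alpha | B cr !=set0 -> (B cr `&` approx_values alpha) !=set0].
have odF cr : open (F cr) /\ dense (F cr).
  have oC : open (~` [set ratr cr.1 : R]).
    by rewrite openC; exact: closed_eq.
  have dC : dense (~` [set ratr cr.1 : R]) by exact: dense_set1C.
  have [B0|B0] := pselect (B cr !=set0); last first.
    have -> : F cr = ~` [set ratr cr.1]; last by split.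
    by apply/seteqP; split=> [alpha []|alpha cr1] //; split=> // /B0.
  have -> : F cr = ~` [set ratr cr.1] `&`
      [set alpha | (B cr `&` approx_values alpha) !=set0].
    by apply/seteqP; split=> alpha [cr1 Balpha]; split=> //; exact: Balpha.
  split; first by apply: openI => //; apply: open_approx_meets; exact: ball_open.
  by apply: denseI => //; exact: dense_approx_meets.
have [|alpha [_ Falpha]] := Baire_countable _ _ _ _ odF setT _ openT.
  by exists 0.
exists alpha; split.
  by move=> [q _ qE]; have [/= + _] := Falpha (q, 0) I; apply; rewrite qE.
apply: dense_limit_point; apply: dense_rat_balls => c r.
by have [_] := Falpha (c, r) I.
Qed.
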